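(* Let $\mathcal{V}$ be a semidegenerate congruence-modular variety, let $A\in\mathcal{V}$ be a semiprime quasi-commutative algebra, and let $\phi$ be a prime congruence of $A$. Then the following are equivalent: (1) $\phi$ is a minimal prime congruence; (2) for any $\alpha\in C(A)$, $\alpha\subseteq\phi$ implies $\alpha^{\perp}\not\subseteq\phi$; (3) for any $\alpha\in C(A)$, $\alpha\subseteq\phi$ if and only if $\alpha^{\perp}\not\subseteq\phi$; (4) for any $\alpha\in K(A)$, $\alpha\subseteq\phi$ implies $\alpha^{\perp}\not\subseteq\phi$; (5) for any $\alpha\in K(A)$, $\alpha\subseteq\phi$ if and only if $\alpha^{\perp}\not\subseteq\phi$.
   Context: Algebras have a fixed finite signature $\tau$. A variety is semidegenerate if none of its nontrivial algebras has a one-element subalgebra. For $A$ in a semidegenerate congruence-modular variety $\mathcal{V}$, $Con(A)$ is the congruence lattice with least element $\Delta_A$ and greatest element $\nabla_A$; $K(A)$ is the set of compact (= finitely generated) congruences (here $\nabla_A\in K(A)$); $PCon(A)$ is the set of principal congruences. $[\cdot,\cdot]$ is the modular commutator of Freese–McKenzie: the greatest operation on congruence lattices of members of $\mathcal{V}$ such that for every surjective morphism $f:A\to B$ and $\alpha,\beta\in Con(A)$, $[\alpha,\beta]_A\subseteq\alpha\cap\beta$ and $[\alpha,\beta]_A\lor Ker(f)=f^{-1}([f(\alpha\lor Ker(f)),f(\beta\lor Ker(f))]_B)$. It is commutative, monotone, distributes over arbitrary joins, and satisfies $[\theta,\nabla_A]=\theta$. The annihilator of $\alpha\in Con(A)$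 is $\alpha^{\perp}=\bigvee\{\gamma\in Con(A)\mid[\alpha,\gamma]=\Delta_A\}$. A congruence $\phi\neq\nabla_A$ is prime if $[\alpha,\beta]\subseteq\phi$ implies $\alpha\subseteq\phi$ or $\beta\subseteq\phi$, for all $\alpha,\beta\in Con(A)$. $Spec(A)$ is the set of prime congruences; a minimal prime congruence is a minimal element of $Spec(A)$ under inclusion. The radical is $\rho(\theta)=\bigwedge\{\phi\in Spec(A)\mid\theta\subseteq\phi\}$. $A$ is semiprime if $\rho(\Delta_A)=\Delta_A$. $C(A)$ is the smallest subset of $Con(A)$ containing $K(A)$ and closed under binary joins and commutators. $A$ is quasi-commutative if for all $\alpha,\beta\in PCon(A)$ there is $\gamma\in K(A)$ with $\gamma\subseteq[\alpha,\beta]$ and $\rho(\gamma)=\rho([\alpha,\beta])$. *)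

(* Defs.v *)
From mathcomp Require Import all_boot.
From mathcomp Require Import boolp classical_sets functions cardinality.

Set Implicit Arguments.
Unset Strict Implicit.
Unset Printing Implicit Defensive.

Local Open Scope classical_set_scope.

Record signature := Signature { op_sym : finType; arity : op_sym -> nat }.

Record algebra (tau : signature) := Algebra {
  carrier :> Type;
  carrier_inh : inhabited carrier;
  interp : forall o : op_sym tau, ('I_(arity o) -> carrier) -> carrier }.

Record hom (tau : signature) (A B : algebra tau) := Hom {
  hom_fun :> A -> B;
  hom_interp : forall (o : op_sym tau) (x : 'I_(arity o) -> A),
    hom_fun (interp x) = interp (fun i => hom_fun (x i)) }.

Definition surj (T U : Type) (f : T -> U) : Prop := forall y, exists x, f x = y.

Definition subuniverse (tau : signature) (A : algebra tau) (S : set A) : Prop :=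
  S !=set0 /\
  forall (o : op_sym tau) (x : 'I_(arity o) -> A),
    (forall i, S (x i)) -> S (interp x).

Lemma prod_inh (I : Type) (F : I -> Type) :
  (forall i, inhabited (F i)) -> inhabited (forall i, F i).
Proof.
move=> h; split=> i.
have hi : exists _ : F i, True by case: (h i) => x; exists x.
exact: projT1 (cid hi).
Qed.

Definition prod_alg (tau : signature) (I : Type) (F : I -> algebra tau) :
    algebra tau :=
  @Algebra tau (forall i, F i) (prod_inh (fun i => carrier_inh (F i)))
    (fun o x i => interp (fun k => x k i)).

(* Closure under subalgebras is stated up to isomorphism, for algebras that
   embed into a member. *)
Record variety (tau : signature) (V : algebra tau -> Prop) : Prop := Variety {
  variety_H : forall (A B : algebra tau) (f : hom A B), surj f -> V A -> V B;
  variety_S : forall (A B : algebra tau) (f : hom A B), injective f -> V B -> V A;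
  variety_P : forall (I : Type) (F : I -> algebra tau),
    (forall i, V (F i)) -> V (prod_alg F) }.

Definition nontrivial (T : Type) : Prop := exists x y : T, x <> y.

Definition semidegenerate (tau : signature) (V : algebra tau -> Prop) : Prop :=
  forall A : algebra tau, V A -> nontrivial A ->
    ~ exists a : A, subuniverse [set a].

Record con (tau : signature) (A : algebra tau) := Con {
  con_rel :> A -> A -> Prop;
  con_refl : forall x, con_rel x x;
  con_sym : forall x y, con_rel x y -> con_rel y x;
  con_trans : forall x y z, con_rel x y -> con_rel y z -> con_rel x z;
  con_interp : forall (o : op_sym tau) (x y : 'I_(arity o) -> A),
    (forall i, con_rel (x i) (y i)) -> con_rel (interp x) (interp y) }.

Definition con_le (tau : signature) (A : algebra tau) (a b : con A) : Prop :=
  forall x y, a x y -> b x y.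

Notation "a <=c b" := (con_le a b) (at level 70, no associativity).

Lemma con_ext (tau : signature) (A : algebra tau) (a b : con A) :
  a <=c b -> b <=c a -> a = b.
Proof.
case: a => ra ? ? ? ?; case: b => rb ? ? ? ? ab ba.
have e : ra = rb by apply/funext=> x; apply/funext=> y; apply/propext; split;
  [exact: ab | exact: ba].
by subst rb; congr Con; exact: Prop_irrelevance.
Qed.

Section Lattice.
Variables (tau : signature) (A : algebra tau).
Implicit Types (a b c : con A) (S : set (con A)).

Definition con_bot : con A.
Proof.
exists (fun x y : A => x = y) => // [x y z -> //|o x y xy].
by congr interp; apply/funext.
Defined.

Definition con_top : con A.
Proof. by refine (@Con tau A (fun _ _ => True) _ _ _ _). Defined.

Definition con_inf S : con A.
Proof.
exists (fun x y : A => forall a, S a -> a x y).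
- by move=> x a _; exact: con_refl.
- by move=> x y h a Sa; apply: con_sym; exact: h.
- by move=> x y z h k a Sa; apply: con_trans (h _ Sa) (k _ Sa).
- by move=> o x y h a Sa; apply: con_interp => i; exact: h.
Defined.

Definition con_sup S : con A := con_inf [set b | forall a, S a -> a <=c b].

Definition con_meet a b : con A := con_inf [set a; b].
Definition con_join a b : con A := con_sup [set a; b].

Definition Cg (R : set (A * A)) : con A :=
  con_inf [set a | forall x y, R (x, y) -> a x y].

Lemma con_le_refl a : a <=c a. Proof. by move=> x y. Qed.

Lemma con_le_trans b a c : a <=c b -> b <=c c -> a <=c c.
Proof. by move=> ab bc x y /ab/bc. Qed.

Lemma con_sup_ub S a : S a -> a <=c con_sup S.
Proof. by move=> Sa x y axy b h; exact: h _ Sa _ _ axy. Qed.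

Lemma con_sup_le S b : (forall a, S a -> a <=c b) -> con_sup S <=c b.
Proof. by move=> h x y hxy; exact: hxy. Qed.

Lemma con_joinl a b : a <=c con_join a b.
Proof. by apply: con_sup_ub; left. Qed.

Lemma con_joinr a b : b <=c con_join a b.
Proof. by apply: con_sup_ub; right. Qed.

Lemma con_join_le a b c : a <=c c -> b <=c c -> con_join a b <=c c.
Proof. by move=> ac bc; apply: con_sup_le => d [->|->]. Qed.

Lemma con_meetP a b x y : con_meet a b x y <-> a x y /\ b x y.
Proof.
split=> [h|[ha hb] c [->|->]] //.
by split; apply: h; [left | right].
Qed.

Lemma Cg_le (R : set (A * A)) a :
  (forall x y, R (x, y) -> a x y) -> Cg R <=c a.
Proof. by move=> h x y hxy; exact: hxy. Qed.

Lemma Cg_gen (R : set (A * A)) x y : R (x, y) -> Cg R x y.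
Proof. by move=> Rxy a h; exact: h. Qed.

Definition compact_con a : Prop :=
  forall S, a <=c con_sup S ->
    exists S0, [/\ finite_set S0, S0 `<=` S & a <=c con_sup S0].

Definition fingen_con a : Prop :=
  exists R : set (A * A), finite_set R /\ a = Cg R.

Definition principal_con a : Prop := exists x y : A, a = Cg [set (x, y)].

Lemma con_supS S S' : S `<=` S' -> con_sup S <=c con_sup S'.
Proof. by move=> h; apply: con_sup_le => a /h; exact: con_sup_ub. Qed.

Lemma compact_conP a : compact_con a <-> fingen_con a.
Proof.
split=> [ca|[R [finR ->]] S RS].
- pose S := [set b | exists p : A * A, a p.1 p.2 /\ b = Cg [set p]].
  have aS : a <=c con_sup S.
    move=> x y axy; apply: (con_sup_ub (a := Cg [set (x, y)])).
      by exists (x, y).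
    exact: Cg_gen.
  have [S0 [fS0 S0S aS0]] := ca S aS.
  have [x0] := carrier_inh A.
  have ex b : exists p : A * A, S0 b -> a p.1 p.2 /\ b = Cg [set p].
    have [/S0S [p hp]|nSb] := pselect (S0 b); first by exists p.
    by exists (x0, x0).
  have [g hg] := choice ex.
  exists (g @` S0); split; first exact: finite_image.
  apply: con_ext.
    apply: (con_le_trans aS0); apply: con_sup_le => b S0b.
    have [_ ->] := hg _ S0b; apply: Cg_le => x y xy.
    by apply: Cg_gen; exists b.
  apply: Cg_le => x y [b S0b gb].
  by have [] := hg _ S0b; rewrite gb.
- pose D x y := exists S0, [/\ finite_set S0, S0 `<=` S & con_sup S0 x y].
  have Drefl x : D x x.
    by exists set0; split; [exact: finite_set0 | exact: sub0set | exact: con_refl].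
  have Dsym x y : D x y -> D y x.
    by case=> S0 [f s h]; exists S0; split => //; exact: con_sym.
  have Dtrans x y z : D x y -> D y z -> D x z.
    case=> S0 [f s h] [S1 [f1 s1 h1]]; exists (S0 `|` S1); split.
    + by rewrite finite_setU.
    + by rewrite subUset.
    + have h0 := con_supS (@subsetUl _ S0 S1) h.
      exact: con_trans h0 (con_supS (@subsetUr _ S0 S1) h1).
  have Dint (o : op_sym tau) (x y : 'I_(arity o) -> A) :
      (forall i, D (x i) (y i)) -> D (interp x) (interp y).
    move=> /choice [F hF]; exists (\bigcup_i F i); split.
    + by apply: bigcup_finite => // i _; case: (hF i).
    + by apply: bigcup_sub => i _; case: (hF i).
    + apply: con_interp => i; have [_ _] := hF i.
      by apply: con_supS => b Fb; exists i.
  pose d := Con Drefl Dsym Dtrans Dint.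
  have Sd : con_sup S <=c d.
    apply: con_sup_le => b Sb x y bxy; exists [set b]; split.
    + exact: finite_set1.
    + by move=> ? ->.
    + by apply: (con_sup_ub (a := b)) bxy.
  have ex (p : A * A) : exists S0, R p ->
      [/\ finite_set S0, S0 `<=` S & con_sup S0 p.1 p.2].
    have [Rp|nRp] := pselect (R p); last by exists set0.
    case: p Rp => x y Rxy.
    have [S0 h] : d x y by apply: Sd; apply: RS; exact: Cg_gen.
    by exists S0.
  have [F hF] := choice ex.
  exists (\bigcup_(p in R) F p); split.
  + by apply: bigcup_finite => // p /hF[].
  + by apply: bigcup_sub => p /hF[].
  + apply: Cg_le => x y Rxy; have [_ _] := hF _ Rxy.
    by apply: con_supS => b Fb; exists (x, y).
Qed.

End Lattice.

Arguments con_bot {tau A}.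
Arguments con_top {tau A}.

Definition congruence_modular (tau : signature) (V : algebra tau -> Prop) : Prop :=
  forall A : algebra tau, V A -> forall a b c : con A, a <=c c ->
    con_join a (con_meet b c) = con_meet (con_join a b) c.

Section Transport.
Variables (tau : signature) (A B : algebra tau) (f : hom A B).

Definition con_preim (b : con B) : con A.
Proof.
exists (fun x y => b (f x) (f y)).
- by move=> x; exact: con_refl.
- by move=> x y; exact: con_sym.
- by move=> x y z; exact: con_trans.
- by move=> o x y h; rewrite !hom_interp; exact: con_interp.
Defined.

Definition hker : con A := con_preim con_bot.

Definition con_image (fS : surj f) (a : con A) (ka : hker <=c a) : con B.
Proof.
exists (fun u v => exists x y, [/\ f x = u, f y = v & a x y]).
- by move=> u; have [x <-] := fS u; exists x, x; split=> //; exact: con_refl.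
- by move=> u v [x [y [<- <- h]]]; exists y, x; split=> //; exact: con_sym.
- move=> u v w [x [y [<- <- h]]] [y' [z [e <- k]]]; exists x, z; split=> //.
  by apply: con_trans h (con_trans (ka _ _ _) k).
- move=> o u v /choice [x /choice [y h]].
  exists (interp x), (interp y); split.
  + by rewrite hom_interp; congr interp; apply/funext=> i; have [] := h i.
  + by rewrite hom_interp; congr interp; apply/funext=> i; have [] := h i.
  + by apply: con_interp => i; have [] := h i.
Defined.

End Transport.

Definition con_op (tau : signature) : Type :=
  forall A : algebra tau, con A -> con A -> con A.

Record commutator_axioms (tau : signature) (V : algebra tau -> Prop)
    (C : con_op tau) : Prop := CommutatorAxioms {
  comm_ax_le : forall A : algebra tau, V A -> forall a b : con A,
    C A a b <=c con_meet a b;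
  comm_ax_hom : forall A B : algebra tau, V A -> V B ->
    forall (f : hom A B) (fS : surj f) (a b : con A),
    con_join (C A a b) (hker f) =
    con_preim f (C B (con_image fS (@con_joinr tau A a (hker f)))
                     (con_image fS (@con_joinr tau A b (hker f)))) }.

(* The pointwise join of all operations satisfying the axioms satisfies them
   too, so this is the greatest one; see [comm_greatest]. *)
Definition comm (tau : signature) (V : algebra tau -> Prop) : con_op tau :=
  fun A a b =>
    con_sup [set g | exists2 C, commutator_axioms V C & g = C A a b].

Lemma comm_greatest (tau : signature) (V : algebra tau -> Prop) :
  commutator_axioms V (comm V) /\
  forall C, commutator_axioms V C ->
    forall A : algebra tau, V A -> forall a b : con A, C A a b <=c comm V a b.
Proof.
split; last first.
  by move=> C hC A _ a b; apply: con_sup_ub; exists C.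
split=> [A VA a b|A B VA VB f fS a b].
  by apply: con_sup_le => _ [C hC ->]; exact: (comm_ax_le hC VA).
set a' := con_image fS _; set b' := con_image fS _.
apply: con_ext.
  apply: con_join_le.
    apply: con_sup_le => _ [C hC ->].
    apply: (con_le_trans (@con_joinl _ _ _ (hker f))).
    rewrite (comm_ax_hom hC VA VB fS) => x y h.
    by apply: (con_sup_ub (a := C B a' b')) h; exists C.
  move=> x y e; change (comm V a' b' (f x) (f y)).
  by have -> : f x = f y := e; exact: con_refl.
set d := con_join _ _.
have kd : hker f <=c d by exact: con_joinr.
have h : comm V a' b' <=c con_image fS kd.
  apply: con_sup_le => _ [C hC ->] u v.
  have [x <-] := fS u; have [y <-] := fS v => Cxy.
  exists x, y; split=> //.
  have : con_preim f (C B a' b') x y by [].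
  rewrite -(comm_ax_hom hC VA VB fS a b).
  apply: con_join_le; last exact: kd.
  apply: (con_le_trans (b := comm V a b)); last exact: con_joinl.
  by apply: con_sup_ub; exists C.
move=> x y /h [x' [y' [ex ey dxy]]].
by apply: con_trans (kd _ _ _) (con_trans dxy (kd _ _ _)).
Qed.

Section Spectrum.
Variables (tau : signature) (V : algebra tau -> Prop) (A : algebra tau).
Implicit Types (a b c p q : con A).

Definition annihilator a : con A := con_sup [set c | comm V a c = con_bot].

Definition prime_con p : Prop :=
  p <> con_top /\
  forall a b, comm V a b <=c p -> a <=c p \/ b <=c p.

Definition minimal_prime p : Prop :=
  prime_con p /\ forall q, prime_con q -> q <=c p -> q = p.

Definition radical a : con A := con_inf [set p | prime_con p /\ a <=c p].

Definition semiprime : Prop := radical con_bot = con_bot.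

Inductive comm_closure : con A -> Prop :=
| CC_compact a : compact_con a -> comm_closure a
| CC_join a b : comm_closure a -> comm_closure b -> comm_closure (con_join a b)
| CC_comm a b : comm_closure a -> comm_closure b -> comm_closure (comm V a b).

Definition quasi_commutative : Prop :=
  forall a b, principal_con a -> principal_con b ->
    exists c, [/\ compact_con c, c <=c comm V a b &
                  radical c = radical (comm V a b)].

End Spectrum.

(* Main.v *)
Require Import Defs.
From mathcomp Require Import all_boot.
From mathcomp Require Import boolp classical_sets functions cardinality.

(** The axioms defining the commutator, together with modularity, already give
    what is needed. Closing an operation satisfying the axioms downwards in
    both arguments yields one that still satisfies them, so the greatest such
    operation is monotone; the homomorphism axiom for the quotient by [psi]
    gives [[psi \/ a, psi \/ b] <= psi \/ [a, b]]. If [phi] is minimal prime and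
    [alpha] is a compact congruence below it with annihilator below it, let [F]
    be the set of compact [gamma] for which some [eps], not below [phi], is such
    that every prime above [gamma] is above [alpha] or [eps]. Quasi-commutativity
    makes [F] closed, up to shrinking, under commutators, and semiprimeness keeps
    the least congruence out of [F]; hence Zorn's lemma gives a prime avoiding
    [F]. It lies below [phi] but not above [alpha], against minimality. *)

Set Implicit Arguments.
Unset Strict Implicit.
Unset Printing Implicit Defensive.

Local Open Scope classical_set_scope.

Lemma finite_total_max (T : Type) (R : T -> T -> Prop) (S : set T) :
  (forall x, R x x) -> (forall x y z, R x y -> R y z -> R x z) ->
  finite_set S -> total_on S R -> S !=set0 ->
  exists2 m, S m & forall s, S s -> R s m.
Proof.
(* A choice structure on [T] lets the finite set be listed as a sequence. *)
elim/Pchoice: T => T in R S * => Rxx Rtr /finite_seqP[s ->].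
elim: s => [|x s IH] tot; first by case.
move=> _; have [[y ys]|s0] := pselect ([set` s] !=set0); last first.
  exists x => [|z]; rewrite /= ?inE ?eqxx // => /orP[/eqP -> //|zs].
  by case: s0; exists z.
have [|m ms mP] := IH _ (ex_intro _ y ys).
  by move=> u v us vs; apply: tot;
    rewrite /= inE ?(us : is_true _) ?(vs : is_true _) orbT.
have ms' : m \in x :: s by rewrite inE (ms : is_true _) orbT.
have [xm|mx] := tot x m (mem_head _ _) ms'.
  by exists m => // z /=; rewrite inE => /orP[/eqP -> //|/mP].
exists x; first exact: mem_head.
by move=> z /=; rewrite inE => /orP[/eqP -> //|/mP zm]; exact: Rtr zm mx.
Qed.

(** * Compact congruences and Zorn's lemma *)

Section Congruences.
Variables (tau : signature) (A : algebra tau).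
Implicit Types a b c : con A.

Lemma con_bot_le a : con_bot <=c a.
Proof. by move=> x y ->; exact: con_refl. Qed.

Lemma con_joinC a b : con_join a b = con_join b a.
Proof.
by apply: con_ext; apply: con_join_le; [exact: con_joinr | exact: con_joinl
  | exact: con_joinr | exact: con_joinl].
Qed.

Lemma con_joinKr a b : con_join (con_join a b) b = con_join a b.
Proof.
apply: con_ext; last exact: con_joinl.
by apply: con_join_le; [exact: con_le_refl | exact: con_joinr].
Qed.

Lemma CgS (R R' : set (A * A)) : R `<=` R' -> Cg R <=c Cg R'.
Proof. by move=> RR'; apply: Cg_le => x y /RR'; exact: Cg_gen. Qed.

Lemma Cg1_le a x y : a x y -> Cg [set (x, y)] <=c a.
Proof. by move=> axy; apply: Cg_le => _ _ [-> ->]. Qed.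

Lemma compact_Cg1 x y : compact_con (Cg [set (x, y)] : con A).
Proof. by apply/compact_conP; exists [set (x, y)]. Qed.

Lemma compact_join a b : compact_con a -> compact_con b ->
  compact_con (con_join a b).
Proof.
move=> /compact_conP[R [fR ->]] /compact_conP[R' [fR' ->]].
apply/compact_conP; exists (R `|` R'); split; first by rewrite finite_setU.
apply: con_ext.
  by apply: con_join_le; apply: CgS; [exact: subsetUl | exact: subsetUr].
apply: Cg_le => x y [Rxy|Rxy].
  by apply: con_joinl; exact: Cg_gen.
by apply: con_joinr; exact: Cg_gen.
Qed.

Definition avoids (F : set (con A)) p := forall g, F g -> ~ g <=c p.

(** A compact [g] in [F] below the join of a chain is below the join of a finite subchain, hence
    below its largest member; an empty subchain would force [g = con_bot], which is excluded. *)
Lemma maximal_avoids (F : set (con A)) :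
  F `<=` @compact_con tau A -> ~ F con_bot ->
  exists p, avoids F p /\ forall q, p <=c q -> avoids F q -> q = p.
Proof.
move=> Fc F0.
pose R (p q : {p | avoids F p}) := `[< sval p <=c sval q >].
have Rxx p : R p p by apply/asboolP; exact: con_le_refl.
have Rtr p q r : R p q -> R q r -> R p r.
  by move=> /asboolP pq /asboolP qr; apply/asboolP; exact: con_le_trans pq qr.
have Ran p q : R p q -> R q p -> p = q.
  case: p q => [p ?] [q ?] /asboolP pq /asboolP qp.
  by apply: eq_exist; exact: con_ext.
have Rch (S : set {p | avoids F p}) : total_on S R ->
    exists q, forall p, S p -> R p q.
  move=> tot; pose S' := [set sval p | p in S].
  have av : avoids F (con_sup S').
    move=> g Fg /(Fc _ Fg)[S0 [fS0 S0S gS0]].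
    have tot0 : total_on S0 (@con_le tau A).
      move=> _ _ /S0S[p Sp <-] /S0S[q Sq <-].
      by have [/asboolP|/asboolP] := tot p q Sp Sq; [left | right].
    have [ne|e] := pselect (S0 !=set0); last first.
      apply: F0; suff <- : g = con_bot by [].
      apply: con_ext (con_bot_le _); apply: (con_le_trans gS0).
      by apply: con_sup_le => a S0a; case: e; exists a.
    have [m /S0S[p _ <-] mP] := finite_total_max (@con_le_refl _ _)
      (fun x y z => @con_le_trans _ _ y x z) fS0 tot0 ne.
    apply: (svalP p _ Fg); apply: (con_le_trans gS0); exact: con_sup_le.
  exists (exist _ _ av) => p Sp; apply/asboolP; apply: con_sup_ub.
  by exists p.
have [[p avp] pmax] := Zorn Rxx Rtr Ran Rch.
exists p; split=> // q pq avq.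
by have [] := pmax (exist _ q avq) (asboolT pq).
Qed.

End Congruences.

(** * Quotient algebras *)

Section Quotient.
Variables (tau : signature) (A : algebra tau) (p : con A).

Lemma quotient_rep : exists r : A -> A,
  (forall x, p x (r x)) /\ forall x y, p x y -> r x = r y.
Proof.
have [x0] := carrier_inh A.
have ex (P : set A) : exists x, P !=set0 -> P x.
  by have [[x Px]|n] := pselect (P !=set0); [exists x | exists x0].
(* Equivalent elements have equal classes [p x], so a choice made from the class as a set depends on
   the class alone. *)
have [g gP] := choice ex.
exists (fun x => g (p x)); split=> [x|x y pxy].
  by apply: gP; exists x; exact: con_refl.
congr g; apply/funext => z; apply/propext; split; last exact: con_trans.
by apply: con_trans; exact: con_sym.
Qed.

(** The quotient is carried by the fixed points of the representative map [r], with operations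
    computed in [A] and then normalised by [r]. *)
Lemma quotient_exists :
  exists (Q : algebra tau) (f : hom A Q), Defs.surj f /\ hker f = p.
Proof.
have [r [rP rE]] := quotient_rep.
have rK x : r (r x) = r x by apply: rE; apply: con_sym.
pose f x : {x | r x = x} := exist _ (r x) (rK x).
have inh : inhabited {x | r x = x}.
  by case: (carrier_inh A) => x; split; exact: f x.
pose Q := @Algebra tau {x | r x = x} inh
  (fun o u => f (interp (fun i => sval (u i)))).
have fE x y : f x = f y <-> p x y.
  split=> [[rxy]|/rE rxy]; last exact: eq_exist.
  by apply: con_trans (rP x) _; rewrite rxy; apply: con_sym.
have fI (o : op_sym tau) (x : 'I_(arity o) -> A) :
    f (interp x) = interp (a := Q) (fun i => f (x i)).
  by apply/fE; apply: con_interp => i; exact: rP.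
exists Q, (@Hom tau A Q f fI); split.
  by case=> x rx; exists x; apply: eq_exist.
by apply: con_ext => x y; [move/fE | move=> pxy; apply/fE].
Qed.

End Quotient.

(** * Images of congruences along surjections *)

Section Image.
Variables (tau : signature) (A B : algebra tau) (f : hom A B) (fS : Defs.surj f).
Implicit Types (a c : con A) (b : con B).

Lemma con_imageE a (ka : hker f <=c a) x y :
  con_image fS ka (f x) (f y) <-> a x y.
Proof.
split=> [[x' [y' [ex ey axy]]]|axy]; last by exists x, y.
by apply: con_trans (ka _ _ _) (con_trans axy (ka _ _ _)).
Qed.

Lemma con_image_le a c (ka : hker f <=c a) (kc : hker f <=c c) :
  a <=c c -> con_image fS ka <=c con_image fS kc.
Proof. by move=> ac _ _ [x [y [<- <- /ac axy]]]; exists x, y. Qed.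

Lemma con_image_eq a c (ka : hker f <=c a) (kc : hker f <=c c) :
  a = c -> con_image fS ka = con_image fS kc.
Proof. by move=> ac; apply: con_ext; apply: con_image_le; rewrite ac. Qed.

Lemma hker_le_preim b : hker f <=c con_preim f b.
Proof. by move=> x y e; rewrite /= (e : f x = f y); exact: con_refl. Qed.

End Image.

(** * Monotonicity of the commutator *)

Section Commutator.
Variables (tau : signature) (V : algebra tau -> Prop).
Hypotheses (V_var : variety V) (V_mod : congruence_modular V).

(* Modularity says that [a /\ f^-1 b] is a preimage of [b] below [a]. *)
Lemma con_image_meet_preim (A B : algebra tau) (VA : V A) (f : hom A B)
    (fS : Defs.surj f) (a : con A) (b : con B) :
  b <=c con_image fS (@con_joinr tau A a (hker f)) ->
  con_image fS (@con_joinr tau A (con_meet a (con_preim f b)) (hker f)) = b.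
Proof.
move=> ba; have kb := @hker_le_preim _ _ _ f b.
have mE : con_join (con_meet a (con_preim f b)) (hker f) = con_preim f b.
  rewrite con_joinC (V_mod VA _ kb); apply: con_ext.
    by move=> x y /con_meetP[].
  move=> x y bxy; apply/con_meetP; split=> //; rewrite con_joinC.
  by apply/(con_imageE fS (@con_joinr tau A a (hker f))); exact: ba.
apply: con_ext => u v; have [x <-] := fS u; have [y <-] := fS v.
  by move/con_imageE; rewrite mE.
by move=> bxy; apply/con_imageE; rewrite mE.
Qed.

Definition down_closure (C : con_op tau) : con_op tau := fun A a b =>
  con_sup [set g | exists a' b', [/\ a' <=c a, b' <=c b & g = C A a' b']].

Lemma down_closure_axioms (C : con_op tau) :
  commutator_axioms V C -> commutator_axioms V (down_closure C).
Proof.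
move=> hC; split=> [A VA a b|A B VA VB f fS a b].
  apply: con_sup_le => _ [a' [b' [aa' bb' ->]]] x y.
  move/(comm_ax_le hC VA)/con_meetP => [ax bx].
  by apply/con_meetP; split; [exact: aa' | exact: bb'].
apply: con_ext.
  apply: con_join_le; last exact: hker_le_preim.
  apply: con_sup_le => _ [a' [b' [aa' bb' ->]]].
  apply: (con_le_trans (@con_joinl _ _ _ (hker f))).
  rewrite (comm_ax_hom hC VA VB fS) => x y h.
  apply: (con_sup_ub (a := C B _ _)) h; do 2!eexists; split; last reflexivity.
    apply: con_image_le; apply: con_join_le (@con_joinr _ _ _ _).
    by apply: con_le_trans aa' _; exact: con_joinl.
  apply: con_image_le; apply: con_join_le (@con_joinr _ _ _ _).
  by apply: con_le_trans bb' _; exact: con_joinl.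
set d := con_join (down_closure C a b) _.
have kd : hker f <=c d by exact: con_joinr.
set fa := con_image fS _; set fb := con_image fS _.
suff h : down_closure C fa fb <=c con_image fS kd.
  by move=> x y dxy; apply/(con_imageE fS kd)/h.
apply: con_sup_le => _ [u [v [ua vb ->]]].
(* By modularity [u] and [v] are images of congruences below [a] and [b], to which the axiom for [C]
   applies. *)
rewrite -(con_image_meet_preim VA ua) -(con_image_meet_preim VA vb).
move=> s t; have [x <-] := fS s; have [y <-] := fS t => Cxy.
apply/con_imageE; set a' := con_meet a _ in Cxy; set b' := con_meet b _ in Cxy.
have : con_join (C A a' b') (hker f) x y by rewrite (comm_ax_hom hC VA VB fS).
apply: con_join_le kd _ _.
apply: con_le_trans (@con_joinl _ _ _ _); apply: con_sup_ub.
by exists a', b'; split=> // ? ? /con_meetP[].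
Qed.

(** * Prime congruences and compact approximation *)

Section Algebra.
Variables (A : algebra tau) (VA : V A).
Implicit Types a b c p q : con A.

Lemma comm_le a b a' b' : a <=c a' -> b <=c b' -> comm V a b <=c comm V a' b'.
Proof.
move=> aa' bb'; have [hC max] := comm_greatest V.
apply: con_le_trans (max _ (down_closure_axioms hC) _ VA a' b').
by apply: con_sup_ub; exists a, b.
Qed.

Lemma comm_lel a b : comm V a b <=c a.
Proof. by move=> x y /(comm_ax_le (comm_greatest V).1 VA)/con_meetP[]. Qed.

Lemma comm_ler a b : comm V a b <=c b.
Proof. by move=> x y /(comm_ax_le (comm_greatest V).1 VA)/con_meetP[]. Qed.

Lemma comm_join_le a b p :
  comm V (con_join a p) (con_join b p) <=c con_join (comm V a b) p.
Proof.
have [Q [f [fS kf]]] := quotient_exists p.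
have VQ : V Q by exact: variety_H V_var _ _ _ fS VA.
rewrite -kf; apply: (con_le_trans (@con_joinl _ _ _ (hker f))).
have hC := (comm_greatest V).1.
rewrite !(comm_ax_hom hC VA VQ fS).
(* Both sides are now preimages of commutators in [Q]; they agree because joining with the kernel
   twice changes nothing. *)
rewrite (con_image_eq fS _ (@con_joinr tau A a (hker f)) (con_joinKr _ _)).
rewrite (con_image_eq fS _ (@con_joinr tau A b (hker f)) (con_joinKr _ _)).
exact: con_le_refl.
Qed.

(** Let [p] be maximal avoiding [F]. If neither [a] nor [b] is below [p], their joins with [p] lie
    above members of [F], whose commutator lies above some [k] in [F]. Then [k] is below the join of
    [comm V a b] and [p], so [comm V a b] is not below [p]. *)
Lemma prime_avoids (F : set (con A)) :
  F `<=` @compact_con tau A -> F !=set0 -> ~ F con_bot ->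
  (forall a b, F a -> F b -> exists2 c, F c & c <=c comm V a b) ->
  exists2 p, prime_con V p & avoids F p.
Proof.
move=> Fc [g0 Fg0] F0 Fm; have [p [avp pmax]] := maximal_avoids Fc F0.
have above a : ~ a <=c p -> exists2 g, F g & g <=c con_join a p.
  move=> nap; apply: contrapT => h; apply: nap.
  rewrite -(pmax (con_join a p)); first exact: con_joinl.
    exact: con_joinr.
  by move=> g Fg gap; apply: h; exists g.
exists p => //; split=> [pT|a b abp]; first by apply: (avp _ Fg0); rewrite pT.
have [|na] := pselect (a <=c p); first by left.
have [|nb] := pselect (b <=c p); first by right.
have [g Fg ga] := above _ na; have [h Fh hb] := above _ nb.
have [k Fk kgh] := Fm _ _ Fg Fh.
case: (avp _ Fk); apply: (con_le_trans kgh); apply: (con_le_trans (comm_le ga hb)).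
apply: (con_le_trans (@comm_join_le _ _ _)).
exact: con_join_le abp (@con_le_refl _ _ _).
Qed.

Lemma radical_le_prime a p : prime_con V p -> a <=c p -> radical V a <=c p.
Proof. by move=> pp ap x y; apply. Qed.

Lemma le_radical a : a <=c radical V a.
Proof. by move=> x y axy p [_]; apply. Qed.

Lemma prime_annihilator a p : prime_con V p ->
  ~ annihilator V a <=c p -> a <=c p.
Proof.
move=> [_ pp] nap; apply: contrapT => na; apply: nap; apply: con_sup_le => c ac.
by have [|//|//] := pp a c; rewrite (ac : comm V a c = _); exact: con_bot_le.
Qed.

Hypothesis A_qc : quasi_commutative V A.

(** Quasi-commutativity treats each pair of generators; the finitely many resulting congruences are
    joined. A prime above the join that misses one generator of [a] must contain every generator of
    [b]. *)
Lemma compact_below_comm a b : compact_con a -> compact_con b ->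
  exists c, [/\ compact_con c, c <=c comm V a b &
    forall p, prime_con V p -> c <=c p -> a <=c p \/ b <=c p].
Proof.
move=> /compact_conP[R [fR ->]] /compact_conP[R' [fR' ->]].
have ex (z : (A * A) * (A * A)) : exists S, [/\ finite_set S,
    Cg S <=c comm V (Cg [set z.1]) (Cg [set z.2]) &
    radical V (Cg S) = radical V (comm V (Cg [set z.1]) (Cg [set z.2]))].
  case: z => [[x y] [x' y']].
  have [||c [/compact_conP[S [fS ->]] cle crad]] :=
    A_qc (a := Cg [set (x, y)]) (b := Cg [set (x', y')]).
  + by exists x, y.
  + by exists x', y'.
  by exists S.
have [S SP] := choice ex; set D := R `*` R'.
exists (Cg (\bigcup_(z in D) S z)); split.
- apply/compact_conP; exists (\bigcup_(z in D) S z); split=> //.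
  by apply: bigcup_finite => [|z _]; [exact: finite_setX | case: (SP z)].
- apply: Cg_le => x y [[[u v] [u' v']] [/= Ruv Ruv'] Sxy].
  have [_ /(_ _ _ (Cg_gen Sxy)) h _] := SP ((u, v), (u', v')).
  by apply: comm_le h; apply: Cg1_le; exact: Cg_gen.
move=> p pp Sp; have [|na] := pselect (Cg R <=c p); first by left.
right; apply: Cg_le => u' v' Ruv'; apply: contrapT => npuv'.
apply: na; apply: Cg_le => u v Ruv.
have [_ _ rE] := SP ((u, v), (u', v')).
have Szp : Cg (S ((u, v), (u', v'))) <=c p.
  apply: con_le_trans Sp; apply: CgS => z Sz.
  by exists ((u, v), (u', v')).
have := radical_le_prime pp Szp; rewrite rE => /(con_le_trans (@le_radical _)).
by case/pp.2 => h; [|case: npuv']; apply: h; exact: Cg_gen.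
Qed.

(** This reduces [comm_closure] to compact congruences: [c] and [a] lie below the same primes. *)
Lemma compact_below_comm_closure a : comm_closure V a ->
  exists c, [/\ compact_con c, c <=c a &
    forall p, prime_con V p -> c <=c p -> a <=c p].
Proof.
elim=> {a} [a ca|a b _ [c [cc ca cp]] _ [d [cd db dp]]
               |a b _ [c [cc ca cp]] _ [d [cd db dp]]].
- by exists a; split=> //; exact: con_le_refl.
- exists (con_join c d); split; first exact: compact_join.
    apply: con_join_le.
      by apply: con_le_trans ca _; exact: con_joinl.
    by apply: con_le_trans db _; exact: con_joinr.
  move=> p pp h; apply: con_join_le.
    by apply: cp => //; apply: con_le_trans h; exact: con_joinl.
  by apply: dp => //; apply: con_le_trans h; exact: con_joinr.
have [e [ce ecd ep]] := compact_below_comm cc cd.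
exists e; split=> //; first exact: con_le_trans ecd (comm_le ca db).
move=> p pp /(ep _ pp)[/(cp _ pp) ap|/(dp _ pp) bp].
  exact: con_le_trans (@comm_lel a b) ap.
exact: con_le_trans (@comm_ler a b) bp.
Qed.

Hypothesis A_semiprime : semiprime V A.

Lemma minimal_prime_annihilator p a : minimal_prime V p ->
  comm_closure V a -> a <=c p -> ~ annihilator V a <=c p.
Proof.
move=> [pp pmin] /compact_below_comm_closure[g [cg ga gP]] ap anp.
pose F := [set c | compact_con c /\ exists e, ~ e <=c p /\
  forall q, prime_con V q -> c <=c q -> a <=c q \/ e <=c q].
have Fprincipal x y : ~ p x y -> F (Cg [set (x, y)]).
  move=> npxy; split; first exact: compact_Cg1.
  exists (Cg [set (x, y)]); split; last by right.
  by apply: contra_not npxy; apply; exact: Cg_gen.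
(* Primes above [g] are above [a], so any [e] not below [p] would serve; [con_top] does. *)
have Fg : F g.
  split=> //; exists con_top; split=> [pT|q qq gq]; last by left; exact: gP gq.
  by apply: pp.1; apply: con_ext.
have [| | |c1 c2|q qq avq] := prime_avoids (F := F).
- by move=> c [].
- by exists g.
(* If [con_bot] were in [F], every prime would be above [a] or [e], hence above [comm V a e].
   Semiprimeness makes this commutator trivial, so [e] is below the annihilator of [a], hence below
   [p]. *)
- move=> [_ [e [nep eP]]]; apply: nep; apply: con_le_trans anp.
  apply: con_sup_ub; apply: con_ext (@con_bot_le _ _ _) => /=.
  rewrite -[X in _ <=c X]A_semiprime => x y h q [qq _].
  by have [aq|eq] := eP _ qq (@con_bot_le _ _ _);
    [exact: aq (comm_lel h) | exact: eq (comm_ler h)].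
- move=> [cc1 [e1 [ne1 e1P]]] [cc2 [e2 [ne2 e2P]]].
  have [c [cc cle cP]] := compact_below_comm cc1 cc2.
  (* Primeness of [p] keeps [comm V e1 e2] from being below [p]. *)
  exists c => //; split=> //; exists (comm V e1 e2).
  split=> [/pp.2[]//|q qq /(cP _ qq)[/(e1P _ qq)|/(e2P _ qq)][]]; try by left.
    by right; exact: con_le_trans (@comm_lel e1 e2) _.
  by right; exact: con_le_trans (@comm_ler e1 e2) _.
(* A pair outside [p] generates a member of [F], which [q] avoids. *)
have qp : q <=c p.
  move=> x y qxy; apply: contrapT => /Fprincipal/avq; apply.
  exact: Cg1_le.
by apply: (avq _ Fg); rewrite (pmin _ qq qp); exact: con_le_trans ga ap.
Qed.

End Algebra.
End Commutator.

(** For a prime [q] below [p] and a pair in [p] but not in [q], the principal congruence of the pair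
    has its annihilator below [q], hence below [p], a contradiction. *)
Lemma minimal_prime_of_annihilator (tau : signature) (V : algebra tau -> Prop)
    (A : algebra tau) (p : con A) : prime_con V p ->
  (forall a, compact_con a -> a <=c p -> ~ annihilator V a <=c p) ->
  minimal_prime V p.
Proof.
move=> pp h; split=> // q qq qp; apply: con_ext => // x y pxy.
apply: contrapT => nqxy; case: (h _ (@compact_Cg1 _ _ x y) (Cg1_le pxy)).
apply: con_le_trans qp; apply: contrapT => /(prime_annihilator qq) h'.
by apply: nqxy; apply: h'; exact: Cg_gen.
Qed.

Unset Implicit Arguments.
Set Strict Implicit.

Theorem theorem4p14 (tau : signature) (V : algebra tau -> Prop)
    (V_var : variety V) (V_semideg : semidegenerate V)
    (V_mod : congruence_modular V)
    (A : algebra tau) (VA : V A)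
    (A_semiprime : semiprime V A) (A_qc : quasi_commutative V A)
    (phi : con A) (phi_prime : prime_con V phi) :
  [<-> minimal_prime V phi;
       forall alpha : con A, comm_closure V alpha ->
         alpha <=c phi -> ~ annihilator V alpha <=c phi;
       forall alpha : con A, comm_closure V alpha ->
         (alpha <=c phi <-> ~ annihilator V alpha <=c phi);
       forall alpha : con A, compact_con alpha ->
         alpha <=c phi -> ~ annihilator V alpha <=c phi;
       forall alpha : con A, compact_con alpha ->
         (alpha <=c phi <-> ~ annihilator V alpha <=c phi)].
Proof.
tfae.
- move=> pmin a ca; exact: minimal_prime_annihilator pmin ca.
- by move=> h a ca; split; [exact: h | exact: prime_annihilator].
- by move=> h a ca ap; apply: (iffLR (h a _)) => //; exact: CC_compact.
- by move=> h a ca; split; [exact: h | exact: prime_annihilator].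
- move=> h; apply: minimal_prime_of_annihilator => // a ca.
  exact: (iffLR (h a ca)).
Qed.
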